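(* For any finite plane tree $T$, the flattening number $f(T)$ and the maximal component number $m(T)$ satisfy $$m(T)=f(T)+2.$$
   Context: **Plane trees and arborescent links.** A plane tree is a finite (non-empty) tree embedded in the plane; what matters is the tree together with the induced cyclic order of the edges at each vertex. A weighted plane tree is a plane tree with an integer $w_v$ attached to each vertex $v$. It determines an arborescent link $L(T)\subset\mathbb{R}^3$ as follows. To each vertex $v$ associate an unknotted band $A_v$ (annulus or Möbius band) with $w_v$ half twists. For each edge incident to $v$ choose a square patch in $A_v$ (a piece of the band running across its full width), these squares being disjoint, lying in an untwisted flat part of $A_v$, and occurring along the core of $A_v$ in the cyclic order prescribed by the plane embedding; all half twists of $A_v$ are placed between two cyclically consecutive squares (a fixed choice of this location at each vertex is part of the convention). For every edge $\{u,v\}$ the bands $A_u$ and $A_v$ are plumbed together: the corresponding squares are identified so that the core direction of $A_u$ matches the transverse direction of $A_v$ and vice versa, and, away from the common square, the part of the surface coming from the component of $T\setminus\{u,v\}$ (edge removed) containing $u$ lies in a ball on one side of the square, disjoint from the part coming from the component containing $v$. The link $L(T)$ is the boundary of the resulting surface. (Equivalently, each vertex is a twist region, and edges indicate how the twisted bands are glued; a tree that is a path gives a two-bridge link, the closure of a rational tangle.) **Maximal component number.** For a plane tree $T$ (without weights), $m(T)$ is the maximal number of components of $L(T)$ over all assignments of integer weights to the vertices of $T$. **Flattening number.** A subset of edges of $T$ is called flattening if the complement of their interiors (i.e. the graph obtained by deleting these edges and keeping all vertices) is a subforest of $T$ with no vertex of valency bigger than two. The number $f(T)$ is the minimal number of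 edges among all flattening subsets of edges of $T$. *)

(* Defs.v *)
(* Plane trees, the boundary curves of the surface obtained
   from them by plumbing twisted bands, and the flattening number. *)
From HB Require Import structures.
From mathcomp Require Import all_boot all_order all_algebra.
From mathcomp Require Import boolp.

Set Implicit Arguments.
Unset Strict Implicit.
Unset Printing Implicit Defensive.

(* [nbrs v] lists the neighbours of [v], hence the edges at [v], in their cyclic
   order; only this order up to rotation of the list is meaningful.  Every
   choice of cyclic orders on a finite tree comes from a plane embedding. *)
Record plane_tree := PlaneTree {
  vertex :> finType;
  nbrs : vertex -> seq vertex;
  nbrs_uniq : forall v, uniq (nbrs v);
  nbrs_irrefl : forall v, v \notin nbrs v;
  nbrs_sym : forall u v, (u \in nbrs v) = (v \in nbrs u);
  vertex_nonempty : 0 < #|vertex|;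
  nbrs_connected : forall u v, connect (grel nbrs) u v;
  nbrs_acyclic : forall c : seq vertex, ucycle (grel nbrs) c -> size c <= 2
}.

Section Flattening.
Variable T : plane_tree.

Definition edges : {set {set T}} :=
  [set [set p.1; p.2] | p : T * T & p.2 \in nbrs p.1].

Definition valency (E : {set {set T}}) (v : T) : nat := #|[set e in E | v \in e]|.

Definition flattening (F : {set {set T}}) : bool :=
  (F \subset edges) && [forall v, valency (edges :\: F) v <= 2].

(* The full edge set is flattening, so the minimum is over a non-empty family. *)
Definition flattening_number : nat :=
  #|[arg min_(F < edges | flattening F) #|F| ]|.

End Flattening.

(* The choices the construction of the surface leaves open.  The half twists of
   the band of [v] are placed just before the square of the first edge of
   [rot (cut v) (nbrs v)].  The two squares of an edge {u, v} can be identified,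
   exchanging core and transverse directions, in four ways, which differ by
   reversals of the two directions; these are recorded by [flip u v] and
   [flip v u]. *)
Record convention (T : plane_tree) := Convention {
  cut : T -> nat;
  flip : T -> T -> bool
}.

Section Boundary.
Variables (T : plane_tree) (c : convention T) (w : T -> int).

(* Going once along its core, the band A_v meets its twisted portion [None] and
   then, in cyclic order, the squares [Some u] of the edges {v, u}; consecutive
   portions are separated by flat untwisted strips.  In the
   one-vertex tree one strip joins the twisted portion to itself. *)
Definition portions (v : T) : seq (option T) :=
  None :: map Some (rot (cut c v) (nbrs v)).

(* The corner [(v, s, a, b)] of the portion [s] of A_v lies on the end at which
   the core of A_v enters ([a = false]) or leaves ([a = true]) the portion, and
   on the left ([b = false]) or right ([b = true]) edge of A_v, left and right
   being constant along everything but the twisted portion. *)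
Definition corner : finType := (T * option T * bool * bool)%type.

Definition is_corner : pred corner :=
  fun p => let: (v, s, _, _) := p in s \in portions v.

(* An edge of a strip runs from an exit corner of a portion to the entry corner
   of the cyclically next one, on the same side of the band. *)
Definition strip_edge (p q : corner) : bool :=
  let: (v, s, a, b) := p in let: (v', s', a', b') := q in
  [&& v' == v, s' == next (portions v) s, a, ~~ a' & b' == b].

(* An edge of the twisted portion changes sides at each of the half twists. *)
Definition twist_edge (p q : corner) : bool :=
  let: (v, s, a, b) := p in let: (v', s', a', b') := q in
  [&& v' == v, s == None, s' == None, ~~ a, a' & b' == iter `|w v|%N negb b].

(* Plumbing: the square of {u, v} in A_u is identified with that in A_v so that
   the core direction of either band is the transverse direction of the other. *)
Definition plumbed (p q : corner) : bool :=
  let: (u, s, a, b) := p in let: (v, s', a', b') := q in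
  [&& s == Some v, s' == Some u, a' == b (+) flip c u v & b' == a (+) flip c v u].

(* The boundary of the plumbed surface consists of the edges of the strips and
   of the twisted portions, joined at the corners; the sides of a square are
   interior to the surface, except for its corners. *)
Definition boundary_adj (p q : corner) : bool :=
  [|| strip_edge p q, strip_edge q p, twist_edge p q, twist_edge q p
    | plumbed p q].

(* Number of components of L(T), the boundary of the plumbed surface. *)
Definition component_number : nat := n_comp boundary_adj is_corner.

End Boundary.

Section MaximalComponentNumber.
Variables (T : plane_tree) (c : convention T).

Definition attained (n : nat) : bool :=
  `[< exists w : T -> int, component_number c w = n >].

Fact attained_ex : exists n, attained n.
Proof.
by exists (component_number c (fun=> 0%R)); apply/asboolP; exists (fun=> 0%R).
Qed.

Fact attained_bound n : attained n -> n <= #|corner T|.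
Proof. by move=> /asboolP[w <-]; exact: max_card. Qed.

Definition max_component_number : nat := ex_maxn attained_ex attained_bound.

End MaximalComponentNumber.

(* Main.v *)
(* Only the parities of the weights matter.  A function from the boundary
   components of the plumbed surface F to F_2 yields a class in H_1(F; F_2);
   this class lies in the radical of the intersection form, whose matrix in the
   basis of the cores of the bands is A + diag(w), with A the adjacency matrix of
   T.  Every element of the radical arises, from exactly two functions, so the
   component number is 1 + corank(A + diag(w)).  Eliminating leaves one by one
   shows that the minimal rank over F_2 of A + diag(w) is the maximal number of
   edges of a subforest with valencies at most two.  This number is
   |E| - f(T) = |V| - 1 - f(T), so the maximal corank is f(T) + 1. *)
Require Import Defs.
From mathcomp Require Import all_boot all_order all_algebra.
From mathcomp Require Import zify.

Set Implicit Arguments.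
Unset Strict Implicit.
Unset Printing Implicit Defensive.

(** * Forests *)

Section Forest.
Variables (V : finType) (adj : rel V).
Hypotheses (adj_sym : symmetric adj) (adj_irr : irreflexive adj).
Hypothesis adj_acyclic : forall c, ucycle adj c -> size c <= 2.

Implicit Types (S : {set V}) (u v x y z : V).

(** A chord from [z] back to [x] would close the part of the path up to [z] into a cycle with at
    least three vertices. *)
Lemma forest_no_chord x y z p :
  path adj x (y :: p) -> uniq (x :: y :: p) -> z \in p -> ~~ adj z x.
Proof.
move=> pxp Uxp zp; apply/negP => zx.
case/splitPr: zp pxp Uxp => p1 p2; rewrite -cat_rcons -cat_cons cat_path => /andP[pxp _].
rewrite -!cat_cons cat_uniq => /andP[Uxp _].
have /adj_acyclic : ucycle adj (x :: y :: rcons p1 z).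
  by rewrite /ucycle Uxp andbT /= rcons_path last_rcons zx andbT.
by rewrite /= size_rcons.
Qed.

(** * Leaves and ends of a forest *)

Definition leaf S v :=
  forall a b, a \in S -> b \in S -> adj v a -> adj v b -> a = b.

Definition path_in S x p := [&& all (mem S) (x :: p), uniq (x :: p) & path adj x p].

Definition longest_path S x p :=
  path_in S x p /\ forall y q, path_in S y q -> size q <= size p.

Lemma longest_path_exists S v : v \in S -> exists x p, longest_path S x p.
Proof.
move=> vS.
pose P n := [exists x, [exists t : n.-tuple V, path_in S x t]].
have exP : exists n, P n.
  exists 0; apply/existsP; exists v; apply/existsP; exists [tuple].
  by rewrite /path_in /= vS.
have ubP n : P n -> n <= #|V|.
  case/existsP=> x /existsP[t /and3P[_ Ut _]].
  have := max_card (mem (x :: t)); rewrite (card_uniqP Ut) /= size_tuple; exact: ltnW.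
case: (ex_maxnP exP ubP) => n /existsP[x /existsP[t xt]] maxn.
exists x, t; split=> // y q yq; rewrite size_tuple; apply: maxn.
by apply/existsP; exists y; apply/existsP; exists (in_tuple q).
Qed.

Lemma path_in_cons S x p z :
  path_in S x p -> z \in S -> z \notin x :: p -> adj x z -> path_in S z (x :: p).
Proof.
case/and3P=> Sxp Uxp pxp zS zxp xz.
by apply/and3P; split; rewrite /= ?zS ?zxp ?(adj_sym z) ?xz.
Qed.

(** A neighbour of [x] off the path would prolong it, and one beyond the second vertex would give a
    chord. *)
Lemma longest_path_end S x p z :
  longest_path S x p -> z \in S -> adj x z -> exists q, p = z :: q.
Proof.
case=> xp maxp zS xz; have [|zxp] := boolP (z \in x :: p); last first.
  by have /maxp := path_in_cons xp zS zxp xz; rewrite /= ltnn.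
rewrite inE => /predU1P[zx|]; first by rewrite zx adj_irr in xz.
case: p xp {maxp} => // y p /and3P[_ Uxp pxp]; rewrite inE => /predU1P[->|zp]; first by exists p.
by rewrite adj_sym (negbTE (forest_no_chord pxp Uxp zp)) in xz.
Qed.

Lemma longest_path_leaf S x p : longest_path S x p -> leaf S x.
Proof.
move=> xp a b aS bS xa xb.
have [q pq] := longest_path_end xp aS xa.
by have [r] := longest_path_end xp bS xb; rewrite pq => -[].
Qed.

Lemma forest_leaf S v : v \in S -> exists2 x, x \in S & leaf S x.
Proof.
move=> /longest_path_exists[x [p xp]]; exists x; last exact: longest_path_leaf xp.
by case: xp => /and3P[/andP[]].
Qed.

(** The shapes a forest can have at the end of a longest path; they are the cases of the induction
    in [card_kernel_lower]. *)
Variant forest_end_spec S : Prop :=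
| IsolatedVertex v of v \in S & (forall z, z \in S -> ~~ adj v z)
| PendantEdge v u of v \in S & u \in S & adj v u & leaf S v & leaf (S :\ v) u
| TwoLeaves v v' u of [/\ v \in S, v' \in S & v != v'] & u \in S & adj v u & adj v' u &
  leaf S v & leaf S v'.

(** Let [x], [y], [p] be a longest path. If [y] has a further neighbour [z] off the path, then [z],
    [y], [p] is also longest, so [x] and [z] are both leaves at [y]. Otherwise, once [x] is removed,
    only the head of [p] can be adjacent to [y]. *)
Lemma forest_end S v : v \in S -> forest_end_spec S.
Proof.
move=> /longest_path_exists[x [p xp]].
have xS : x \in S by case: xp => /and3P[/andP[]].
case: p xp => [|y p] xyp.
  apply: (@IsolatedVertex _ x) => // z zS; apply/negP => xz.
  by have [q] := longest_path_end xyp zS xz.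
have [/and3P[/and3P[_ yS pS] Uxyp /andP[xy pyp]] maxp] := xyp.
have lx := longest_path_leaf xyp.
have ypP : path_in S y p by apply/and3P; split; [exact/andP|case/andP: Uxyp|].
have [/existsP[z /and4P[zS zx yz zp]]|noz] :=
    boolP [exists z, [&& z \in S, z != x, adj y z & z \notin p]].
  have zyp : z \notin y :: p.
    by rewrite inE negb_or zp andbT; apply: contraL yz => /eqP->; rewrite adj_irr.
  have lz : longest_path S z (y :: p) by split=> //; exact: path_in_cons.
  apply: (@TwoLeaves _ x z y) => //; first by split; rewrite // eq_sym.
    by rewrite adj_sym.
  exact: longest_path_leaf lz.
apply: (@PendantEdge _ x y) => //.
have nbr_y a : a \in S :\ x -> adj y a -> exists q, p = a :: q.
  rewrite !inE => /andP[ax aS] ya.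
  have {noz} ap : a \in p.
    by move/existsPn: noz => /(_ a); rewrite aS ax ya /= negbK.
  case: p pyp {pS xyp maxp ypP} Uxyp ap => // b p pyp /andP[_ Uyp].
  rewrite inE => /predU1P[->|ap]; first by exists p.
  by rewrite adj_sym (negbTE (forest_no_chord pyp Uyp ap)) in ya.
move=> a b aS bS ya yb.
have [q pq] := nbr_y a aS ya.
by have [r] := nbr_y b bS yb; rewrite pq => -[].
Qed.

Lemma leaf_ind (P : {set V} -> Prop) :
    P set0 -> (forall S v, v \in S -> leaf S v -> P (S :\ v) -> P S) ->
  forall S, P S.
Proof.
move=> P0 Pleaf S; have [n] := ubnP #|S|; elim: n S => // n IHn S leSn.
have [->//|[v vS]] := set_0Vmem S.
have [x xS lx] := forest_leaf vS.
apply: (Pleaf _ x) => //; apply: IHn.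
by move: leSn; rewrite (cardsD1 x S) xS.
Qed.

Lemma big_leaf S v (F : V -> bool) :
    leaf S v -> (forall u, adj v u -> u \notin S -> F u = false) ->
  forall u, adj v u -> u \in S -> \big[addb/false]_(z | adj v z) F z = F u.
Proof.
move=> lv F0 u vu uS; rewrite (bigD1 u) //= big1 ?addbF // => z /andP[vz zu].
apply: F0 => //; apply: contra zu => zS.
by rewrite (lv z u).
Qed.

(** * Cycles, potentials and the number of edges *)

(** A forest has no nonzero 1-cycle over F_2: when all edges leaving [S] carry 0, the cycle
    condition at a leaf of [S] kills its last edge, and the leaf can be removed from [S]. *)
Lemma forest_cycle_space (d : V -> V -> bool) :
    (forall u v, d u v = d v u) ->
    (forall u, \big[addb/false]_(v | adj u v) d u v = false) ->
  forall u v, adj u v -> d u v = false.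
Proof.
move=> d_sym d_cycle.
suff dS S : (forall u v, adj u v -> u \notin S -> d u v = false) ->
    forall u v, adj u v -> d u v = false.
  by apply: (dS setT) => u v _; rewrite inE.
elim/leaf_ind: S => [d0 u v uv|S x xS lx IH dS]; first by rewrite d0 ?inE.
apply: IH => u v uv; rewrite !inE negb_and negbK => /predU1P[ux|uS]; last exact: dS.
rewrite {u}ux in uv *.
have dx z : adj x z -> z \notin S -> d x z = false.
  by move=> xz zS; rewrite d_sym dS // adj_sym.
have [vS|] := boolP (v \in S); last exact: dx.
by rewrite -(big_leaf lx dx uv vS).
Qed.

(** Dually, every 1-cochain is a coboundary: a leaf added to [S] has at most one edge into it, and
    its value is chosen to satisfy that edge. *)
Lemma forest_potential (g : V -> V -> bool) :
    (forall u v, g u v = g v u) ->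
  exists t : V -> bool, forall u v, adj u v -> t u (+) t v = g u v.
Proof.
move=> g_sym.
suff [t tP] : exists t : V -> bool,
    {in setT &, forall u v, adj u v -> t u (+) t v = g u v}.
  by exists t => u v; apply: tP; rewrite inE.
elim/leaf_ind: [set: V] => [|S x xS lx [t tP]].
  by exists (fun=> false) => u v; rewrite inE.
pose t' u := if u == x then
  (if [pick z | (z \in S) && adj x z] is Some z then t z (+) g x z else false) else t u.
have t'x v : v \in S -> adj x v -> t' x (+) t' v = g x v.
  move=> vS xv; have vx : v != x by apply: contraL xv => /eqP->; rewrite adj_irr.
  rewrite /t' eqxx (negbTE vx); case: pickP => [z /andP[zS xz]|/(_ v)]; last by rewrite vS xv.
  by rewrite (lx z v) //; case: (t v); case: (g x v).
exists t' => u v uS vS uv.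
have [ux|ux] := eqVneq u x; first by rewrite ux t'x // -ux.
have [vx|vx] := eqVneq v x; first by rewrite vx addbC t'x // -vx // adj_sym.
by rewrite /t' (negbTE ux) (negbTE vx) tP // !inE ?ux ?vx.
Qed.

Definition graph_edges : {set {set V}} :=
  [set e | [exists p, adj p.1 p.2 && (e == [set p.1; p.2])]].

Lemma graph_edgesP e :
  reflect (exists u v, adj u v /\ e = [set u; v]) (e \in graph_edges).
Proof.
rewrite inE; apply: (iffP existsP) => [[[u v] /= /andP[uv /eqP->]]|[u [v [uv ->]]]].
  by exists u, v.
by exists (u, v); rewrite uv eqxx.
Qed.

Lemma edge_neq u v : adj u v -> u != v.
Proof. by apply: contraL => /eqP->; rewrite adj_irr. Qed.

Lemma edge_other e v : e \in graph_edges -> v \in e -> exists2 u, adj v u & e = [set v; u].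
Proof.
case/graph_edgesP=> a [b [ab ->]]; rewrite !inE => /predU1P[->|/eqP->]; first by exists b.
by exists a; [rewrite adj_sym | rewrite setUC].
Qed.

(** A function on the vertices amounts to its value at [r] and its coboundary: injectivity is
    connectedness, surjectivity is [forest_potential]. Hence 2^|V| = 2 * 2^|E|. *)
Lemma tree_card_edges (r : V) :
  (forall u v, connect adj u v) -> #|V| = #|graph_edges|.+1.
Proof.
move=> adj_conn.
pose df (t : {ffun V -> bool}) : {ffun {set V} -> bool} :=
  [ffun e => (e \in graph_edges) && \big[addb/false]_(v in e) t v].
have dfE t u v : adj u v -> df t [set u; v] = t u (+) t v.
  move=> uv; rewrite ffunE big_setU1 ?big_set1 /=; last by rewrite inE edge_neq.
  by have -> : [set u; v] \in graph_edges by apply/graph_edgesP; exists u, v.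
pose f (t : {ffun V -> bool}) := (t r, df t).
have f_inj : injective f.
  move=> t t' [ttr tt]; apply/ffunP => v.
  have tcl : closed adj [pred v | t v == t' v].
    move=> a b ab; rewrite !inE.
    have := dfE t _ _ ab; rewrite tt dfE //.
    by case: (t a); case: (t b); case: (t' a); case: (t' b).
  have := closed_connect tcl (adj_conn r v).
  by rewrite !inE ttr eqxx => /esym/eqP.
have f_im : [set f t | t in setT] = setX setT [set h in pffun_on false (mem graph_edges) predT].
  apply/setP => -[b h]; rewrite !inE /=; apply/imsetP/pffun_onP => [[t _ [_ ->]]|[/subsetP h0 _]].
    split=> //; apply/subsetP => e; rewrite inE ffunE; by case: (e \in _).
  have [t tP] := @forest_potential (fun u v => h [set u; v]) (fun u v => congr1 h (setUC _ _)).
  pose s := b (+) t r; exists [ffun v => t v (+) s] => //.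
  congr (_, _); first by rewrite ffunE /s; case: b {s}; case: (t r).
  apply/ffunP => e; have [eE|eE] := boolP (e \in graph_edges).
    case/graph_edgesP: (eE) => u [v [uv ->]]; rewrite dfE // !ffunE -tP //.
    by case: (t u); case: (t v); case: s.
  by rewrite ffunE (negbTE eE); apply: contraNF eE => he; apply: h0; rewrite inE he.
have := card_in_imset (in2W f_inj : {in setT &, injective f}).
rewrite f_im cardsX !cardsT card_ffun cardsE card_pffun_on.
have -> : #|predT : {pred bool}| = 2 by rewrite -[RHS]card_bool; apply: eq_card.
by rewrite -expnS => /eqP; rewrite eqn_exp2l // => /eqP <-.
Qed.


(** * Subforests with valencies at most two *)

Definition degree_in (K : {set {set V}}) v := #|[set e in K | v \in e]|.

Definition linear_forest S (K : {set {set V}}) :=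
  [/\ {subset K <= graph_edges}, forall e, e \in K -> e \subset S
    & forall v, degree_in K v <= 2].

Lemma degree_inU1 e (K : {set {set V}}) v : degree_in (e |: K) v <= (v \in e) + degree_in K v.
Proof.
rewrite /degree_in; have [ve|ve] := boolP (v \in e).
  apply: leq_trans (_ : #|e |: [set e in K | v \in e]| <= _); last first.
    by rewrite cardsU1 leq_add2r leq_b1.
  apply/subset_leq_card/subsetP => a; rewrite !inE.
  by case: (a == e).
apply/subset_leq_card/subsetP => a; rewrite !inE => /andP[/predU1P[->|->]] //.
by rewrite (negbTE ve).
Qed.

Lemma card_degree_in (K : {set {set V}}) v : #|K| = degree_in K v + #|[set e in K | v \notin e]|.
Proof.
rewrite -(cardsID [set e : {set V} | v \in e] K).
by congr (_ + _); apply: eq_card => e; rewrite !inE // andbC.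
Qed.

(** The hypothesis covers both a vertex outside [S] and a vertex of [S] without neighbours in
    [S]. *)
Lemma degree_in_eq0 S K v :
  linear_forest S K -> (forall u, u \in S -> adj v u -> v \notin S) -> degree_in K v = 0.
Proof.
case=> KE KS _ nv; apply: eq_card0 => e; rewrite !inE; apply/negP => /andP[eK ve].
have [u vu def_e] := edge_other (KE e eK) ve.
have /subsetP eS := KS e eK.
have uS : u \in S by apply: eS; rewrite def_e set22.
by have := nv u uS vu; rewrite eS.
Qed.

Lemma degree_in_leaf S K v : linear_forest S K -> leaf S v -> degree_in K v <= 1.
Proof.
case=> KE KS _ lv; apply/card_le1_eqP => e f; rewrite !inE => /andP[eK ve] /andP[fK vf].
have [a va def_e] := edge_other (KE e eK) ve.
have [b vb def_f] := edge_other (KE f fK) vf.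
rewrite def_e def_f (lv a b) //.
  by apply: (subsetP (KS e eK)); rewrite def_e !inE eqxx orbT.
by apply: (subsetP (KS f fK)); rewrite def_f !inE eqxx orbT.
Qed.

Lemma linear_forest_del S K v :
  linear_forest S K -> linear_forest (S :\ v) [set e in K | v \notin e].
Proof.
case=> KE KS K2; split=> [e|e|w]; first by rewrite inE => /andP[/KE].
  by rewrite inE subsetD1 => /andP[/KS-> ->].
by apply: leq_trans (K2 w); apply/subset_leq_card/subsetP => e; rewrite !inE => /andP[/andP[-> _]].
Qed.

Lemma linear_forestU1 S S' K v u :
    linear_forest S K -> S \subset S' -> u \in S' -> v \in S' -> adj u v ->
    degree_in K u <= 1 -> degree_in K v <= 1 ->
  linear_forest S' ([set u; v] |: K).
Proof.
case=> KE KS K2 SS' uS vS uv Ku Kv; split=> [e|e|w].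
- by rewrite in_setU1 => /predU1P[->|/KE//]; apply/graph_edgesP; exists u, v.
- rewrite in_setU1 => /predU1P[->|/KS/subset_trans]; last exact.
  by apply/subsetP => w; rewrite !inE => /predU1P[->|/eqP->].
- apply: leq_trans (degree_inU1 _ _ _) _; rewrite !inE.
  have [->|_] /= := eqVneq w u; first by rewrite ltnS.
  by have [->|_] /= := eqVneq w v; rewrite ?ltnS // add0n.
Qed.

(** * Kernels over F_2 *)

Definition nbr_sum (x : {ffun V -> bool}) v := \big[addb/false]_(u | adj v u) x u.

(* Vectors over F_2 supported on [S] in the kernel of the principal submatrix
   with index set [S] of the adjacency matrix plus the diagonal matrix [D]. *)
Definition kernel S (D : V -> bool) : {set {ffun V -> bool}} :=
  [set x : {ffun V -> bool} |
    [forall v, if v \in S then nbr_sum x v == D v && x v else ~~ x v]].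

Lemma kernelP S D (x : {ffun V -> bool}) :
  reflect ((forall v, v \notin S -> x v = false) /\
           forall v, v \in S -> nbr_sum x v = D v && x v) (x \in kernel S D).
Proof.
rewrite inE; apply: (iffP forallP) => [xP|[x0 xP] v].
  by split=> v vS; have := xP v; [rewrite (negbTE vS) => /negbTE | rewrite vS => /eqP].
by case: ifPn => [/xP->//|/x0->].
Qed.

Definition set_at v b (x : {ffun V -> bool}) : {ffun V -> bool} :=
  [ffun u => if u == v then b else x u].

Lemma set_at_id v (x : {ffun V -> bool}) : set_at v (x v) x = x.
Proof. by apply/ffunP => u; rewrite ffunE; case: eqP => // ->. Qed.

Lemma set_at_set v b b' (x : {ffun V -> bool}) : set_at v b (set_at v b' x) = set_at v b x.
Proof. by apply/ffunP => u; rewrite !ffunE; case: eqP. Qed.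

Lemma set_atE v b (x : {ffun V -> bool}) : set_at v b x v = b.
Proof. by rewrite ffunE eqxx. Qed.

Lemma set_at_neq v b (x : {ffun V -> bool}) u : u != v -> set_at v b x u = x u.
Proof. by rewrite ffunE => /negbTE->. Qed.

Lemma nbr_sum_set (x : {ffun V -> bool}) v b u :
  nbr_sum (set_at v b x) u = (adj u v && (b (+) x v)) (+) nbr_sum x u.
Proof.
have eq_off w : w != v -> set_at v b x w = x w by apply: set_at_neq.
rewrite /nbr_sum; have [uv|uv] := boolP (adj u v).
  rewrite !(bigD1 (P := adj u) v) //= set_atE (eq_bigr x); last first.
    by move=> w /andP[_ /eq_off].
  by case: b {eq_off}; case: (x v); case: (\big[_/_]_(_ | _) _).
apply: eq_bigr => w uw; apply: eq_off.
by apply: contraNneq uv => <-.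
Qed.

Lemma nbr_sum_leaf S (x : {ffun V -> bool}) v u :
    leaf S v -> u \in S -> adj v u -> (forall w, w \notin S -> x w = false) ->
  nbr_sum x v = x u.
Proof. by move=> lv uS vu x0; apply: big_leaf lv _ _ vu uS => w _; apply: x0. Qed.

(* Gaussian elimination at a leaf: a leaf with diagonal entry 1 is a pivot, and a
   leaf with diagonal entry 0 together with its neighbour spans a hyperbolic plane. *)
Lemma card_kernel_upper S K D :
  linear_forest S K -> #|kernel S D| * 2 ^ #|K| <= 2 ^ #|S|.
Proof.
have [n] := ubnP #|S|; elim: n S K D => // n IHn S K D leSn SK.
have [S0|[v0 v0S]] := set_0Vmem S.
  have -> : #|K| = 0.
    have [KE KS _] := SK; apply: eq_card0 => e; apply/negP => eK.
    have /graph_edgesP[u [v [_ def_e]]] := KE e eK.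
    by have /subsetP/(_ u) := KS e eK; rewrite def_e S0 !inE eqxx => /(_ isT).
  rewrite S0 cards0 expn0 muln1.
  apply: leq_trans (_ : #|[set [ffun=> false] : {ffun V -> bool}]| <= 1); last by rewrite cards1.
  apply/subset_leq_card/subsetP => x /kernelP[x0 _]; rewrite inE.
  by apply/eqP/ffunP => v; rewrite ffunE x0 ?inE.
have [v vS lv] := forest_leaf v0S.
have Sv : #|S| = #|S :\ v|.+1 by rewrite (cardsD1 v) vS.
have ltSvn : #|S :\ v| < n by rewrite -ltnS -Sv.
have [/existsP[u /andP[uS vu]]|iso] := boolP [exists u, (u \in S) && adj v u]; last first.
  have Kv : degree_in K v = 0.
    apply: degree_in_eq0 SK _ => u uS vu.
    by case/negP: iso; apply/existsP; exists u; rewrite uS.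
  have {IHn} := IHn _ _ D ltSvn (linear_forest_del v SK).
  rewrite (card_degree_in K v) Kv add0n Sv expnS -(leq_pmul2l (isT : 0 < 2)) mulnA => le_k.
  apply: leq_trans le_k; rewrite leq_mul2r; apply/orP; right.
  (* For an isolated [v], forgetting the coordinate [x v] costs at most a factor 2. *)
  pose f (x : {ffun V -> bool}) := (x v, set_at v false x).
  have f_inj : injective f.
    by move=> x y [xy /(congr1 (set_at v (x v)))]; rewrite !set_at_set set_at_id xy set_at_id.
  rewrite -(card_imset _ f_inj) -card_bool -cardsT -cardsX.
  apply/subset_leq_card/subsetP => _ /imsetP[x /kernelP[x0 xS] ->]; rewrite in_setX inE.
  apply/kernelP; split=> w; rewrite !inE ?negb_and ?negbK.
    by rewrite ffunE; case: eqP => //= _; apply: x0.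
  move=> /andP[wv wS]; rewrite nbr_sum_set set_at_neq // xS //.
  case wv': (adj w v) => //; case/negP: iso.
  by apply/existsP; exists w; rewrite wS adj_sym.
have nbr_v w : w \in S -> adj w v -> w = u by move=> wS wv; apply: lv => //; rewrite adj_sym.
have uv : u != v by apply: contraL vu => /eqP->; rewrite adj_irr.
have [Dv|Dv] := boolP (D v).
  (* Row [v] reads [x v = x u]. Substituting it into row [u] adds 1 to the diagonal entry there,
     while [K] loses at most one edge. *)
  pose D' w := D w (+) (w == u).
  have := IHn _ _ D' ltSvn (linear_forest_del v SK).
  have := degree_in_leaf SK lv.
  rewrite (card_degree_in K v) Sv; move: (degree_in K v) #|[set _ in _ | _]| => d k d1.
  have le_ker : #|kernel S D| <= #|kernel (S :\ v) D'|.
    rewrite -(card_in_imset (f := set_at v false)); last first.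
      move=> x y /kernelP[x0 xS] /kernelP[y0 yS] xy.
      rewrite -[x](set_at_id v) -[y](set_at_id v).
      have:= xS v vS; have:= yS v vS; rewrite Dv /= (nbr_sum_leaf lv uS) // => <-.
      rewrite (nbr_sum_leaf lv uS) // => <-.
      have := congr1 (fun z : {ffun V -> bool} => z u) xy; rewrite !set_at_neq // => ->.
      by have := congr1 (set_at v (y u)) xy; rewrite !set_at_set.
    apply/subset_leq_card/subsetP => _ /imsetP[x /kernelP[x0 xS] ->].
    apply/kernelP; split=> w; rewrite !inE ?negb_and ?negbK.
      by rewrite ffunE; case: eqP => //= _; apply: x0.
    move=> /andP[wv wS]; rewrite nbr_sum_set set_at_neq // xS // /D'.
    have [wu|wu] := eqVneq w u; last first.
      by rewrite addbF; case wv': (adj w v) => //; rewrite (nbr_v w wS wv') eqxx in wu.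
    have := xS v vS; rewrite Dv (nbr_sum_leaf lv uS) //= => <-.
    by rewrite wu adj_sym vu; case: (x u); case: (D u).
  move=> le_k; apply: leq_trans (_ : #|kernel (S :\ v) D'| * (2 * 2 ^ k) <= _).
    by rewrite leq_mul // -expnS leq_exp2l // -add1n leq_add2r.
  by rewrite mulnCA expnS leq_mul2l.
(* Row [v] now reads [x u = 0], and row [u] expresses [x v] through the other coordinates. Both
   vertices go, and [K] loses at most the two edges at [u]. *)
have Su : #|S :\ v| = #|S :\ u :\ v|.+1.
  by rewrite (cardsD1 u) !inE uv uS /= setDDl setUC -setDDl.
have ltSun : #|S :\ u :\ v| < n by rewrite Su in ltSvn; exact: ltnW.
have SKu := linear_forest_del u SK.
have Kv0 : degree_in [set e in K | u \notin e] v = 0.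
  apply: degree_in_eq0 SKu _ => w; rewrite !inE => /andP[wu wS] vw.
  by rewrite (lv w u) ?eqxx // in wu.
have := IHn _ _ D ltSun (linear_forest_del v SKu).
have [_ _ /(_ u)] := SK.
rewrite (card_degree_in K u) (card_degree_in [set e in K | u \notin e] v) Kv0 Sv Su add0n.
move: (degree_in K u) #|[set _ in _ | _]| => d k d2.
have le_ker : #|kernel S D| <= #|kernel (S :\ u :\ v) D|.
  have xu0 (x : {ffun V -> bool}) : x \in kernel S D -> x u = false.
    move=> /kernelP[x0 xS]; have := xS v vS.
    by rewrite (negbTE Dv) (nbr_sum_leaf lv uS).
  have xvE (x : {ffun V -> bool}) : x \in kernel S D -> x v = nbr_sum (set_at v false x) u.
    move=> xK; have /kernelP[x0 xS] := xK.
    by rewrite nbr_sum_set xS // xu0 // andbF addbF adj_sym vu.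
  rewrite -(card_in_imset (f := set_at v false)); last first.
    move=> x y xK yK xy; have := xvE x xK; rewrite xy -xvE // => xyv.
    rewrite -[x](set_at_id v) -[y](set_at_id v) xyv.
    by have := congr1 (set_at v (y v)) xy; rewrite !set_at_set.
  apply/subset_leq_card/subsetP => _ /imsetP[x xK ->]; have /kernelP[x0 xS] := xK.
  apply/kernelP; split=> w; rewrite !inE ?negb_and ?negbK.
    rewrite ffunE; case: eqP => //= _; have [->|_] /= := eqVneq w u; last exact: x0.
    by rewrite xu0.
  move=> /and3P[wv wu wS]; rewrite nbr_sum_set set_at_neq // xS //.
  by case wv': (adj w v) => //; rewrite (nbr_v w wS wv') eqxx in wu.
move=> le_k; apply: leq_trans (_ : #|kernel (S :\ u :\ v) D| * (2 ^ 2 * 2 ^ k) <= _).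
  by rewrite leq_mul // -expnD leq_exp2l // leq_add2r.
by rewrite mulnCA !expnS -mulnA !leq_mul2l.
Qed.

(* At a pendant edge e, adding the rank one matrix 1_e 1_e^T to a matrix for the
   forest without its leaf gains the edge e; if a vertex has two leaves, adding
   its row and its column, of rank at most two, gains both pendant edges. *)
Lemma card_kernel_lower S :
  exists K D, linear_forest S K /\ 2 ^ #|S| <= #|kernel S D| * 2 ^ #|K|.
Proof.
have [n] := ubnP #|S|; elim: n S => // n IHn S leSn.
have [S0|[v0 v0S]] := set_0Vmem S.
  exists set0, (fun=> false); split; first split=> [e|e|v]; rewrite ?inE //.
    by rewrite leqW // leqW // leqn0; apply/eqP/eq_card0 => e; rewrite !inE.
  rewrite S0 !cards0 muln1 expn0 card_gt0; apply/set0Pn; exists [ffun=> false].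
  by apply/kernelP; split=> v; rewrite ?inE // ffunE.
have [v vS iso|v u vS uS vu lv lu|v v' u [vS v'S vv'] uS vu v'u lv lv'] := forest_end v0S.
- have Sv : #|S| = #|S :\ v|.+1 by rewrite (cardsD1 v) vS.
  have /IHn[K [D [SK leK]]] : #|S :\ v| < n by rewrite -ltnS -Sv.
  (* A zero diagonal entry at the isolated vertex leaves its coordinate free, doubling the
     kernel. *)
  pose D' w := (w != v) && D w.
  exists K, D'; split.
    by have [KE KS K2] := SK; split=> // e /KS /subset_trans; apply; apply: subsetDl.
  rewrite Sv expnS; apply: leq_trans (leq_mul (leqnn 2) leK) _.
  rewrite mulnA leq_mul2r; apply/orP; right.
  pose f (p : bool * {ffun V -> bool}) := set_at v p.1 p.2.
  rewrite -card_bool -cardsT -cardsX -(card_in_imset (f := f)).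
    apply/subset_leq_card/subsetP => _ /imsetP[[b x] + ->].
    rewrite in_setX inE /= => /kernelP[x0 xS].
    apply/kernelP; split=> w wS.
      have wv : w != v by apply: contraNneq wS => ->.
      by rewrite set_at_neq // x0 // !inE negb_and wS orbT.
    rewrite nbr_sum_set adj_sym (negbTE (iso w wS)) /= /D'.
    have [->|wv] /= := eqVneq w v; last by rewrite set_at_neq // xS // !inE wv.
    by rewrite /nbr_sum big1 // => z vz; apply: x0; rewrite !inE negb_and (contraL (iso z)) ?orbT.
  move=> [b x] [c y]; rewrite !in_setX !in_setT /= => /kernelP[x0 _] /kernelP[y0 _] xy.
  have vSv : v \notin S :\ v by rewrite !inE eqxx.
  have := congr1 (fun z : {ffun V -> bool} => z v) xy; rewrite !set_atE /= => ->.
  have := congr1 (set_at v false) xy; rewrite !set_at_set /=.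
  by rewrite -{1}(x0 v vSv) -{1}(y0 v vSv) !set_at_id => ->.
- have Sv : #|S| = #|S :\ v|.+1 by rewrite (cardsD1 v) vS.
  have /IHn[K [D [SK leK]]] : #|S :\ v| < n by rewrite -ltnS -Sv.
  have Kv : degree_in K v = 0 by apply: degree_in_eq0 SK _ => *; rewrite !inE eqxx.
  have vK : [set v; u] \notin K.
    have [_ KS _] := SK; apply/negP => /KS /subsetP/(_ v).
    by rewrite !inE !eqxx => /(_ isT).
  pose D' w := (w == v) || (D w (+) (w == u)).
  exists ([set v; u] |: K), D'; split.
    apply: (linear_forestU1 SK); rewrite ?Kv ?subsetDl //.
    exact: degree_in_leaf SK lu.
  rewrite Sv cardsU1 vK add1n !expnS mulnCA leq_mul2l /=; apply: leq_trans leK _.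
  rewrite leq_mul2r; apply/orP; right.
  (* Row [v] forces [x v = x u]; in row [u] this new term cancels the change of the diagonal
     entry. *)
  pose f (x : {ffun V -> bool}) := set_at v (x u) x.
  rewrite -(card_in_imset (f := f)).
    apply/subset_leq_card/subsetP => _ /imsetP[x /kernelP[x0 xS] ->].
    have xv : x v = false by rewrite x0 // !inE eqxx.
    apply/kernelP; split=> w wS.
      have wv : w != v by apply: contraNneq wS => ->.
      by rewrite set_at_neq // x0 // !inE negb_and wS orbT.
    rewrite nbr_sum_set xv addbF /D'; have [->|wv] /= := eqVneq w v.
      rewrite adj_irr set_atE (nbr_sum_leaf lv uS) // => z zS.
      by rewrite x0 // !inE negb_and zS orbT.
    rewrite set_at_neq // xS ?inE ?wv //.
    have [->|wu] := eqVneq w u; first by rewrite adj_sym vu; case: (x u); case: (D u).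
    case wv': (adj w v); last by rewrite addbF.
    by rewrite (lv w u) ?eqxx // adj_sym in wu.
  move=> x y /kernelP[x0 _] /kernelP[y0 _] xy.
  have := congr1 (set_at v false) xy; rewrite !set_at_set.
  have vSv : v \notin S :\ v by rewrite !inE eqxx.
  by rewrite -{1}(x0 v vSv) -{1}(y0 v vSv) !set_at_id.
have uv : u != v by apply: contraL vu => /eqP->; rewrite adj_irr.
have uv' : u != v' by apply: contraL v'u => /eqP->; rewrite adj_irr.
set S' := S :\ u :\ v.
have SS' : #|S| = #|S'|.+2 by rewrite (cardsD1 u) uS (cardsD1 v) !inE eq_sym uv vS.
have notS' w : w \notin S -> w \notin S' by apply: contra; rewrite !inE => /and3P[].
have uS' : u \notin S' by rewrite !inE eqxx andbF.
have vS' : v \notin S' by rewrite !inE eqxx.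
have /IHn[K [D [SK leK]]] : #|S'| < n by rewrite SS' in leSn; apply: ltnW.
have K0 w : w \notin S' -> degree_in K w = 0 by move=> wS; apply: degree_in_eq0 SK _.
have Kv' : degree_in K v' = 0.
  apply: degree_in_eq0 SK _ => z; rewrite !inE => /and3P[_ zu zS] v'z.
  by rewrite (lv' z u) ?eqxx in zu.
have SK1 : linear_forest S ([set v'; u] |: K).
  apply: (linear_forestU1 SK); rewrite ?Kv' ?K0 //.
  by apply/subsetP => w; rewrite !inE => /and3P[].
have vK1 : degree_in ([set v'; u] |: K) v = 0.
  apply/eqP; rewrite -leqn0; apply: leq_trans (degree_inU1 _ _ _) _.
  by rewrite K0 // !inE (negbTE vv') eq_sym (negbTE uv).
have v'K : [set v'; u] \notin K.
  have [_ KS _] := SK; apply/negP => /KS /subsetP/(_ u).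
  by rewrite !inE !eqxx orbT !andbF => /(_ isT).
have vK : [set v; u] \notin [set v'; u] |: K.
  apply/negP => vuK; move/eqP: vK1; rewrite cards_eq0 => /eqP/setP/(_ [set v; u]).
  by rewrite inE vuK !inE eqxx.
pose D' w := (w != v) && D w.
exists ([set v; u] |: ([set v'; u] |: K)), D'; split.
  apply: (linear_forestU1 SK1); rewrite ?vK1 //.
  by apply: leq_trans (degree_inU1 _ _ _) _; rewrite K0 // addn0 leq_b1.
rewrite SS' cardsU1 vK cardsU1 v'K !add1n !expnS ![#|_| * (2 * _)]mulnCA !leq_mul2l /=.
apply: leq_trans leK _; rewrite leq_mul2r; apply/orP; right.
(* As [x u = 0], row [u] asks that the coordinates at the neighbours of [u] sum to 0, which dictates
   [x v]; the rows of [v] and of the other leaf [v'] see only [x u]. *)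
pose f (x : {ffun V -> bool}) := set_at v (nbr_sum x u) x.
rewrite -(card_in_imset (f := f)).
  apply/subset_leq_card/subsetP => _ /imsetP[x /kernelP[x0 xS] ->].
  apply/kernelP; split=> w wS.
    have wv : w != v by apply: contraNneq wS => ->.
    by rewrite set_at_neq // x0 // notS'.
  rewrite nbr_sum_set (x0 v) // addbF /D'; have [->|wv] /= := eqVneq w v.
    by rewrite adj_irr (nbr_sum_leaf lv uS) ?x0 // => z zS; rewrite x0 // notS'.
  rewrite set_at_neq //; have [->|wu] := eqVneq w u.
    by rewrite adj_sym vu addbb x0 ?andbF.
  rewrite (xS w); last by rewrite in_setD1 wv in_setD1 wu.
  case wv': (adj w v) => //.
  by rewrite (lv w u) ?eqxx // adj_sym in wu.
move=> x y /kernelP[x0 _] /kernelP[y0 _] xy.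
have := congr1 (set_at v false) xy; rewrite !set_at_set.
by rewrite -{1}(x0 v vS') -{1}(y0 v vS') !set_at_id.
Qed.

End Forest.

(** * Plumbed bands *)

Section Cyclic.
Variables (I : finType) (s : seq I).
Hypothesis s_uniq : uniq s.

Lemma next_invariant (f : I -> bool) :
  {in s, forall i, f (next s i) = f i} -> {in s &, forall i j, f i = f j}.
Proof.
move=> fP i j si sj.
have f_closed : fclosed (next s) [pred k | f k].
  move=> k _ /eqP<-; rewrite !inE; have [/fP->//|sk] := boolP (k \in s).
  (* Outside [s], [next s] is the identity. *)
  by rewrite next_nth (negbTE sk).
have := closed_connect f_closed (_ : fconnect (next s) i j); rewrite !inE; apply.
by rewrite (fconnect_cycle (cycle_next s_uniq)).
Qed.

Lemma big_next (f : I -> bool) :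
  \big[addb/false]_(i <- s) f (next s i) = \big[addb/false]_(i <- s) f i.
Proof.
rewrite !big_uniq // [RHS](reindex_inj (can_inj (prev_next s_uniq))).
by apply: eq_bigl => i; rewrite mem_next.
Qed.

(** A primitive of [f] around the cycle, with [a] as in [corner]: the value on entering or on
    leaving portion [i]. *)
Definition partial_sum (f : I -> bool) i (a : bool) :=
  \big[addb/false]_(j <- take (index i s + a) s) f j.

Lemma partial_sum_true f i :
  i \in s -> partial_sum f i true = partial_sum f i false (+) f i.
Proof.
move=> si; rewrite /partial_sum addn1 addn0 (take_nth i) ?index_mem //.
by rewrite nth_index // -cats1 big_cat big_seq1.
Qed.

(** The vanishing of the total sum is what makes the primitive close up from the last entry to the
    first. *)
Lemma partial_sum_next f i :
    \big[addb/false]_(j <- s) f j = false -> i \in s ->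
  partial_sum f i true = partial_sum f (next s i) false.
Proof.
move=> f0 si; rewrite /partial_sum addn1 addn0 next_nth si.
case: s s_uniq si f0 => // x p xp_uniq xpi f0; set k := index i (x :: p).
have [kp|pk] := ltnP k (size p).
  by rewrite -[nth x p k]/(nth x (x :: p) k.+1) index_uniq.
(* At the last entry [nth] returns its default [x], the head of the list, which is the cyclic
   successor. *)
rewrite nth_default // [X in _ = \big[_/_]_(_ <- take X _) _]/= eqxx take0 big_nil.
by rewrite take_oversize.
Qed.

End Cyclic.

(** * Counting components by locally constant functions *)

Section LocallyConstant.
Variables (I : finType) (e : rel I) (a : pred I).

Definition locally_constant : {set {ffun I -> bool}} :=
  [set f : {ffun I -> bool} |
    [forall i, f i ==> a i] && [forall i, forall j, e i j ==> (f i == f j)]].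

Lemma locally_constantP (f : {ffun I -> bool}) :
  reflect ((forall i, ~~ a i -> f i = false) /\ forall i j, e i j -> f i = f j)
          (f \in locally_constant).
Proof.
rewrite inE; apply: (iffP andP) => [[/forallP f0 /forallP fe]|[f0 fe]]; split.
- by move=> i ai; apply: contraNF ai; apply/implyP.
- by move=> i j ij; have /forallP/(_ j)/implyP/(_ ij)/eqP := fe i.
- by apply/forallP => i; apply/implyP => fi; apply: contraTT fi => /f0->.
- by apply/forallP => i; apply/forallP => j; apply/implyP => /fe->.
Qed.

(** Such a function is determined by its values at the roots of the components inside [a], and these
    values are arbitrary. *)
Lemma card_locally_constant :
  symmetric e -> closed e a -> #|locally_constant| = 2 ^ n_comp e a.
Proof.
move=> /sym_connect_sym e_sym a_cl.
pose R : {pred I} := [predI roots e & a].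
pose res (f : {ffun I -> bool}) : {ffun I -> bool} := [ffun i => (i \in R) && f i].
have aroot i : a (fingraph.root e i) = a i.
  by have := closed_connect a_cl (connect_root e i); rewrite /in_mem /= => ->.
have f_root f i : f \in locally_constant -> f (fingraph.root e i) = f i.
  move=> /locally_constantP[_ fe].
  have fcl : closed e [pred j | f j] by move=> j k; apply: fe.
  exact/esym/(closed_connect fcl (connect_root e i)).
have res_inj : {in locally_constant &, injective res}.
  move=> f g fL gL fg; apply/ffunP => i.
  have [ai|ai] := boolP (a i); last first.
    by case/locally_constantP: fL => -> //; case/locally_constantP: gL => ->.
  have := congr1 (fun h : {ffun I -> bool} => h (fingraph.root e i)) fg.
  by rewrite !ffunE !inE [_ \in a]aroot ai roots_root // !f_root.
rewrite -(card_in_imset res_inj).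
have -> : 2 ^ n_comp e a = #|pffun_on false R (predT : {pred bool})|.
  by rewrite card_pffun_on -[in LHS]card_bool; congr (_ ^ _); apply: eq_card.
apply: eq_card => h; apply/imsetP/pffun_onP => [[f _ ->]|[/subsetP h0 _]].
  by split=> //; apply/subsetP => i; rewrite inE ffunE; case: (i \in R).
exists [ffun i => a i && h (fingraph.root e i)].
  apply/locally_constantP; split=> i; first by rewrite ffunE => /negbTE->.
  move=> j ij; rewrite !ffunE (fingraph.rootP e_sym (connect1 ij)).
  by have /= := a_cl i j ij; rewrite /in_mem /= => ->.
apply/ffunP => i; rewrite !ffunE; have [iR|iR] := boolP (i \in R).
  by case/andP: (iR) => /eqP->; rewrite /in_mem /= => ->.
by apply: contraNF iR => hi; apply: h0; rewrite inE hi.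
Qed.

End LocallyConstant.

(** * Boundary components and the kernel *)

Definition tree_adj (T : plane_tree) : rel T := fun u v => v \in nbrs u.

Section Plumbing.
Variables (T : plane_tree) (c : convention T) (w : T -> int).

Local Notation adj := (@tree_adj T).
Local Notation odd_twist v := (odd `|w v|%N).

Lemma tree_sym : symmetric adj.
Proof. by move=> u v; exact: nbrs_sym. Qed.

Lemma tree_irr : irreflexive adj.
Proof. by move=> v; apply/negbTE/nbrs_irrefl. Qed.

Lemma iter_negb n b : iter n negb b = odd n (+) b.
Proof. by elim: n => //= n ->; rewrite addNb. Qed.

Lemma portions_uniq v : uniq (portions c v).
Proof.
rewrite /= map_inj_uniq ?rot_uniq ?nbrs_uniq ?andbT; last exact: Some_inj.
by apply/negP => /mapP[].
Qed.

Lemma mem_portions v u : (Some u \in portions c v) = adj v u.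
Proof. by rewrite inE /= mem_map ?mem_rot //; exact: Some_inj. Qed.

Lemma big_portions v (F : option T -> bool) :
  \big[addb/false]_(s <- portions c v) F s =
  F None (+) \big[addb/false]_(u | adj v u) F (Some u).
Proof.
rewrite big_cons big_map big_uniq ?rot_uniq ?nbrs_uniq //; congr addb.
by apply: eq_bigl => u; rewrite mem_rot.
Qed.

Lemma plumbed_sym : symmetric (plumbed c).
Proof.
move=> [[[u s] a] b] [[[v s'] a'] b'] /=.
by apply/and4P/and4P => -[-> -> /eqP-> /eqP->]; rewrite !addbK.
Qed.

Lemma boundary_adj_sym : symmetric (boundary_adj c w).
Proof.
move=> p q; rewrite /boundary_adj plumbed_sym.
by rewrite orbCA; congr (_ || (_ || _)); rewrite orbCA.
Qed.

Lemma is_corner_closed : closed (boundary_adj c w) (is_corner c).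
Proof.
have strip p q : strip_edge c p q -> is_corner c p = is_corner c q.
  case: p q => [[[u s] a] b] [[[v s'] a'] b'] /and4P[/eqP-> /eqP-> _ _].
  by rewrite /is_corner mem_next.
have twist p q : twist_edge w p q -> is_corner c p = is_corner c q.
  by case: p q => [[[u s] a] b] [[[v s'] a'] b'] /and4P[/eqP-> /eqP-> /eqP-> _].
move=> p q; rewrite /in_mem /= => /or4P[/strip|/strip|/twist|/orP[/twist|]] //.
case: p q => [[[u s] a] b] [[[v s'] a'] b'] /and4P[/eqP-> /eqP-> _ _].
by rewrite /is_corner !mem_portions tree_sym.
Qed.

Definition boundary_functions : {set {ffun corner T -> bool}} :=
  locally_constant (boundary_adj c w) (is_corner c).

(** Since adjacency preserves [is_corner], the equations need only be imposed at genuine corners. *)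
Lemma boundary_functionsP (f : {ffun corner T -> bool}) :
  reflect [/\ forall p, ~~ is_corner c p -> f p = false,
     forall v s b, s \in portions c v -> f (v, s, true, b) = f (v, next (portions c v) s, false, b),
     forall v b, f (v, None, false, b) = f (v, None, true, odd_twist v (+) b)
   & forall u v a b, adj u v ->
       f (u, Some v, a, b) = f (v, Some u, b (+) flip c u v, a (+) flip c v u)]
   (f \in boundary_functions).
Proof.
apply: (iffP (locally_constantP _ _ _)) => [[f0 fe]|[f0 f_strip f_twist f_plumb]]; split=> //.
- by move=> v s b sv; apply: fe; rewrite /boundary_adj /= !eqxx.
- by move=> v b; apply: fe; rewrite /boundary_adj /= iter_negb !eqxx !orbT.
- by move=> u v a b uv; apply: fe; rewrite /boundary_adj /= !eqxx !orbT.
have strip p q : strip_edge c p q -> f p = f q.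
  move=> pq; have [pc|pc] := boolP (is_corner c p); last first.
    have qc : ~~ is_corner c q.
      have := is_corner_closed (_ : boundary_adj c w p q).
      by rewrite /in_mem /= => <-; rewrite // /boundary_adj pq.
    by rewrite !f0.
  case: p q pq pc => [[[u s] a] b] [[[v s'] a'] b'].
  by case/and5P=> /eqP-> /eqP-> -> /negbTE-> /eqP-> /f_strip->.
have twist p q : twist_edge w p q -> f p = f q.
  case: p q => [[[u s] a] b] [[[v s'] a'] b'].
  case/and5P=> /eqP-> /eqP-> /eqP-> /negbTE-> /andP[-> /eqP->].
  by rewrite iter_negb -f_twist.
move=> p q /or4P[/strip|/strip|/twist|/orP[/twist|]] //.
move=> pq; have [pc|pc] := boolP (is_corner c p); last first.
  have qc : ~~ is_corner c q.
    have := is_corner_closed (_ : boundary_adj c w p q).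
    by rewrite /in_mem /= => <-; rewrite // /boundary_adj pq !orbT.
  by rewrite !f0.
case: p q pq pc => [[[u s] a] b] [[[v s'] a'] b'].
case/and4P=> /eqP-> /eqP-> /eqP-> /eqP->; rewrite /is_corner mem_portions => uv.
exact: f_plumb.
Qed.

(* Coefficient on the core of A_v of the class in H_1(F; F_2) of the boundary
   components on which [f] takes the value 1. *)
Definition core_class (f : {ffun corner T -> bool}) : {ffun T -> bool} :=
  [ffun v => f (v, None, false, false) (+) f (v, None, false, true)].

(** Strips and half twists preserve the difference between the two sides of the band; only the
    squares require an argument, which uses that [T] is a tree. *)
Lemma core_classE (f : {ffun corner T -> bool}) v s a :
    f \in boundary_functions -> s \in portions c v ->
  f (v, s, a, false) (+) f (v, s, a, true) = core_class f v.
Proof.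
case/boundary_functionsP=> _ f_strip f_twist f_plumb sv.
pose d u r a' := f (u, r, a', false) (+) f (u, r, a', true).
have d_twist u : d u None true = d u None false.
  by rewrite /d !f_twist; case: (odd_twist u); rewrite // addbC.
have d_strip u r : r \in portions c u -> d u r true = d u (next (portions c u) r) false.
  by move=> ru; rewrite /d !f_strip.
(* The sums of [f] over the corners of the squares form a 1-cycle of the tree
   with coefficients in F_2, and there is no such cycle but 0. *)
pose D u v := d u (Some v) false (+) d u (Some v) true.
pose D' u v := adj u v && D u v.
have D_sym u v' : D' u v' = D' v' u.
  rewrite /D' tree_sym; case vu: (adj v' u) => //=; rewrite /D /d !(f_plumb v' u) //.
  by case: (flip c u v'); case: (flip c v' u) => /=; do 4 case: (f _).
(* Once around the core of A_u, the changes of [d] telescope along the strips. *)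
have D_cycle u : \big[addb/false]_(v | adj u v) D' u v = false.
  have := big_portions u (fun r => d u r false (+) d u r true).
  rewrite d_twist addbb addFb (eq_bigr (D' u)) => [<-|r ur]; last by rewrite /D' ur.
  rewrite big_split /= [X in _ (+) X](eq_big_seq (fun r => d u (next (portions c u) r) false)).
    by rewrite (big_next (portions_uniq u) (fun r => d u r false)) addbb.
  exact: d_strip.
have D0 u r : r \in portions c u -> d u r true = d u r false.
  case: r => [u'|_]; last exact: d_twist.
  rewrite mem_portions => uu'.
  have := forest_cycle_space tree_sym tree_irr (@nbrs_acyclic T) D_sym D_cycle uu'.
  by rewrite /D' uu' /D /=; case: (d _ _ _); case: (d _ _ _).
have -> : f (v, s, a, false) (+) f (v, s, a, true) = d v s false by case: a; rewrite // -D0.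
rewrite ffunE; apply: (next_invariant (portions_uniq v) (f := fun r => d v r false)) => // r rv.
by rewrite -d_strip // D0.
Qed.

(** The changes of [f] along the left side of A_v, once around, sum to 0. Crossing the square of [u]
    goes across A_u and contributes its coefficient; the twisted portion contributes that of [v]
    when it switches sides. This is row [v]. *)
Lemma core_class_kernel (f : {ffun corner T -> bool}) :
  f \in boundary_functions ->
  core_class f \in kernel adj setT (fun v => odd_twist v).
Proof.
move=> fB; have /boundary_functionsP[_ f_strip f_twist f_plumb] := fB.
apply/kernelP; split=> v; rewrite inE // => _.
pose d r := f (v, r, false, false) (+) f (v, r, true, false).
have d_sum : \big[addb/false]_(r <- portions c v) d r = false.
  rewrite big_split /=.
  rewrite [X in _ (+) X](eq_big_seq (fun r => f (v, next (portions c v) r, false, false))).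
    by rewrite (big_next (portions_uniq v) (fun r => f (v, r, false, false))) addbb.
  by move=> r; exact: f_strip.
have dE u : adj v u -> d (Some u) = core_class f u.
  move=> vu; rewrite /d !(f_plumb v u) //.
  rewrite -(core_classE (s := Some v) (false (+) flip c v u) fB) ?mem_portions 1?tree_sym //.
  by case: (flip c u v) => //=; rewrite addbC.
have dN : d None = odd_twist v && core_class f v.
  rewrite /d f_twist -(core_classE (s := None) true fB) ?inE //.
  by case: (odd_twist v) => /=; rewrite ?addbb // addbC.
move: d_sum; rewrite big_portions dN (eq_bigr _ dE) -/(nbr_sum _ _ _).
by case: (nbr_sum _ _ _); case: (_ && _).
Qed.

(* Crossing the square of {u, v} along A_u changes the value by [x v], so that
   [f] is determined by [x] and by its value [t v] at one corner of each band;
   plumbing prescribes the differences of [t] along the edges. *)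
Lemma boundary_function_exists (x : {ffun T -> bool}) v0 b0 :
    x \in kernel adj setT (fun v => odd_twist v) ->
  exists2 f, f \in boundary_functions & f (v0, None, false, false) = b0 /\ core_class f = x.
Proof.
case/kernelP=> _ xK.
(* The prescribed change of [f] along the left side across each portion; the kernel equation makes
   the total 0. *)
pose y v s := if s is Some u then x u else odd_twist v && x v.
have y0 v : \big[addb/false]_(s <- portions c v) y v s = false.
  by rewrite big_portions /= -[\big[_/_]_(_ | _) _]/(nbr_sum adj x v) xK ?inE // addbb.
pose J v := partial_sum (portions c v) (y v).
(* The plumbing equation solved for [t u (+) t v]; the terms in [a] and [b] cancel. *)
pose g u v := J u (Some v) false (+) J v (Some u) false
              (+) ((flip c u v && x u) (+) (flip c v u && x v)).
have g_sym u v : g u v = g v u.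
  by rewrite /g; congr (_ (+) _); rewrite addbC.
have [t tP] := forest_potential tree_sym tree_irr (@nbrs_acyclic T) g_sym.
(* The constant [t v0 (+) b0] normalizes the value at the base corner, and [b && x v] is the
   difference between the sides. *)
pose f : {ffun corner T -> bool} := [ffun p => is_corner c p &&
  (let: (v, s, a, b) := p in t v (+) (t v0 (+) b0) (+) (b && x v) (+) J v s a)].
have fE v s a b : s \in portions c v ->
    f (v, s, a, b) = t v (+) (t v0 (+) b0) (+) (b && x v) (+) J v s a.
  by rewrite ffunE /is_corner => ->.
have J0 v : J v None false = false by rewrite /J /partial_sum /= big_nil.
have NoneP v : None \in portions c v by rewrite inE.
exists f; last split.
- apply/boundary_functionsP; split.
  + by move=> p pc; rewrite ffunE (negbTE pc).
  + move=> v s b sv; rewrite !fE ?mem_next //.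
    by rewrite /J (partial_sum_next (portions_uniq v)).
  + move=> v b; rewrite !fE // [J v _ true]partial_sum_true // -/(J v _ _) J0 /=.
    by case: (odd_twist v); case: b; case: (x v); case: (t v); case: (_ (+) b0).
  move=> u v a b uv; have vu : adj v u by rewrite tree_sym.
  rewrite !fE ?mem_portions //.
  have /esym := tP u v uv; rewrite /g.
  have Ju a' : J u (Some v) a' = J u (Some v) false (+) (a' && x v).
    by case: a'; rewrite ?addbF // /J partial_sum_true ?mem_portions.
  have Jv a' : J v (Some u) a' = J v (Some u) false (+) (a' && x u).
    by case: a'; rewrite ?addbF // /J partial_sum_true ?mem_portions.
  rewrite (Ju a) (Jv (b (+) _)) !andb_addl.
  move: (J u _ _) (J v _ _) (_ (+) b0) (t u) (t v) (a && _) (b && _) (_ && _) (_ && _).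
  by do 9 case.
- by rewrite fE // J0 addKb !addbF.
by apply/ffunP => v; rewrite ffunE !fE // J0; case: (t v); case: (_ (+) b0); case: (x v).
Qed.

(** With zero class, [f] agrees on the two sides of each band, hence is constant on each band, and
    then everywhere by connectedness of [T]. *)
Lemma boundary_function_const (f : {ffun corner T -> bool}) v0 p :
    f \in boundary_functions -> core_class f = [ffun=> false] -> is_corner c p ->
  f p = f (v0, None, false, false).
Proof.
move=> fB f0; have /boundary_functionsP[_ f_strip f_twist f_plumb] := fB.
have f_side v s a b : s \in portions c v -> f (v, s, a, b) = f (v, s, a, false).
  move=> sv; have := core_classE a fB sv; rewrite f0 ffunE.
  by case: b => //; case: (f _); case: (f _).
(* The two ends of a square in one band are its two sides in the other. *)
have f_end v s a b : s \in portions c v -> f (v, s, a, b) = f (v, s, false, false).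
  case: a => [|/f_side//]; case: s => [u|] sv; last first.
    by rewrite -[RHS](f_side v _ _ (odd_twist v (+) b)) // f_twist addKb.
  have vu : adj v u by rewrite -mem_portions.
  have uv : Some v \in portions c u by rewrite mem_portions tree_sym.
  by rewrite f_side // !(f_plumb v u) // f_side // [RHS]f_side.
have f_band v s a b : s \in portions c v -> f (v, s, a, b) = f (v, None, false, false).
  move=> sv; rewrite f_end //.
  apply: (next_invariant (portions_uniq v) (f := fun r => f (v, r, false, false))) => // r rv.
  by rewrite -f_strip // f_end.
case: p => [[[v s] a] b] sv; rewrite f_band //.
have cl : closed adj [pred v | f (v, None, false, false)].
  move=> u u' uu'; rewrite !inE.
  rewrite -(f_band u (Some u') false false) ?mem_portions //.
  by rewrite f_plumb // f_band // mem_portions tree_sym.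
exact: (closed_connect cl (@nbrs_connected T v v0)).
Qed.

(** The sum of two functions with the same data has zero class and vanishes at the base corner, so
    it is 0 by [boundary_function_const]. *)
Lemma boundary_functions_inj v0 :
  {in boundary_functions &,
    injective (fun f : {ffun corner T -> bool} => (f (v0, None, false, false), core_class f))}.
Proof.
move=> f g fB gB [fg fg_class].
pose h : {ffun corner T -> bool} := [ffun p => f p (+) g p].
have hB : h \in boundary_functions.
  case/locally_constantP: fB => f0 fe; case/locally_constantP: gB => g0 ge.
  apply/locally_constantP; split=> [p pc|p q pq]; rewrite !ffunE; first by rewrite f0 ?g0.
  by rewrite (fe p q) // (ge p q).
have h0 : core_class h = [ffun=> false].
  apply/ffunP => v; have /ffunP/(_ v) := fg_class; rewrite !ffunE.
  by do 4 case: (_ (_, _)).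
apply/ffunP => p; have [pc|pc] := boolP (is_corner c p); last first.
  case/boundary_functionsP: fB => f0 _ _ _; case/boundary_functionsP: gB => g0 _ _ _.
  by rewrite f0 ?g0.
have := boundary_function_const v0 hB h0 pc; rewrite !ffunE fg addbb.
by case: (f p); case: (g p).
Qed.

(** Both sides count [boundary_functions]: by components, and by base value and core class. *)
Lemma component_number_kernel :
  2 ^ component_number c w = 2 * #|kernel adj setT (fun v => odd_twist v)|.
Proof.
have /card_gt0P[v0 _] := vertex_nonempty T.
rewrite -(card_locally_constant boundary_adj_sym is_corner_closed) -/boundary_functions.
rewrite -(card_in_imset (@boundary_functions_inj v0)) -card_bool -cardsT -cardsX.
apply: eq_card => -[b x]; rewrite in_setX in_setT /=.
apply/imsetP/idP => [[f fB [_ ->]]|xK]; first exact: core_class_kernel.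
by have [f fB [fb fx]] := boundary_function_exists v0 b xK; exists f; rewrite // fb fx.
Qed.

End Plumbing.

(** * Comparison with the flattening number *)

Lemma tree_edges (T : plane_tree) : edges T = graph_edges (@tree_adj T).
Proof.
apply/setP => e; apply/imsetP/graph_edgesP => [[[u v] + ->]|[u [v [uv ->]]]].
  by rewrite inE; exists u, v.
by exists (u, v); rewrite ?inE.
Qed.

Lemma linear_forest_flattening (T : plane_tree) (F : {set {set T}}) :
  flattening F -> linear_forest (@tree_adj T) setT (edges T :\: F).
Proof.
case/andP=> _ /forallP F2; split=> // e.
by rewrite inE tree_edges => /andP[].
Qed.

Lemma flattening_linear_forest (T : plane_tree) (K : {set {set T}}) :
  linear_forest (@tree_adj T) setT K -> flattening (edges T :\: K).
Proof.
case=> /subsetP KE _ K2; rewrite /flattening subsetDl; apply/forallP => v.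
by rewrite setDDr setDv set0U tree_edges (setIidPr KE); apply: K2.
Qed.

(** In the constant 2, one unit is the factor 2 of [component_number_kernel], the other comes from
    |V| = |E| + 1. *)
Lemma component_number_upper (T : plane_tree) (c : convention T) w (F : {set {set T}}) :
  flattening F -> component_number c w <= #|F| + 2.
Proof.
move=> Ff; have FE : F \subset edges T by case/andP: Ff.
have /card_gt0P[v0 _] := vertex_nonempty T.
have := card_kernel_upper (@tree_sym T) (@tree_irr T) (@nbrs_acyclic T)
  (fun v => odd `|w v|%N) (linear_forest_flattening Ff).
rewrite cardsT.
rewrite (tree_card_edges (@tree_sym T) (@tree_irr T) (@nbrs_acyclic T) v0 (@nbrs_connected T)).
rewrite -tree_edges -(leq_pmul2l (isT : 0 < 2)) mulnA -(component_number_kernel c) -expnD -expnS.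
rewrite leq_exp2l // cardsD (setIidPr FE).
have := subset_leq_card FE; lia.
Qed.

Lemma component_number_lower (T : plane_tree) (c : convention T) :
  exists w (F : {set {set T}}), flattening F /\ #|F| + 2 <= component_number c w.
Proof.
have [K [D [KL]]] := card_kernel_lower (@tree_sym T) (@tree_irr T) (@nbrs_acyclic T) setT.
have /card_gt0P[v0 _] := vertex_nonempty T.
(* Weights 0 and 1 realize every diagonal over F_2. *)
pose w v : int := Posz (D v).
have -> : kernel (@tree_adj T) setT D = kernel (@tree_adj T) setT (fun v => odd `|w v|%N).
  have oddw v : odd `|w v|%N = D v by rewrite /w; case: (D v).
  by apply/setP => x; apply/kernelP/kernelP => -[x0 xK]; split=> // v vS; rewrite xK // oddw.
rewrite cardsT.
rewrite (tree_card_edges (@tree_sym T) (@tree_irr T) (@nbrs_acyclic T) v0 (@nbrs_connected T)).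
rewrite -tree_edges -(leq_pmul2l (isT : 0 < 2)) mulnA -(component_number_kernel c) -expnD -expnS.
rewrite leq_exp2l // => le_w.
exists w, (edges T :\: K); split; first exact: flattening_linear_forest.
have KE : K \subset edges T by apply/subsetP; rewrite tree_edges; case: KL.
have := subset_leq_card KE; rewrite cardsD (setIidPr KE); lia.
Qed.

Lemma edges_flattening (T : plane_tree) : flattening (edges T).
Proof.
rewrite /flattening subxx; apply/forallP => v; rewrite setDv /valency.
by rewrite leqW // leqW // leqn0; apply/eqP/eq_card0 => e; rewrite !inE.
Qed.

Theorem proposition2 (T : plane_tree) (c : convention T) :
  max_component_number c = flattening_number T + 2.
Proof.
rewrite /flattening_number; case: arg_minnP => [|F Ff minF]; first exact: edges_flattening.
rewrite /max_component_number; case: ex_maxnP => n /boolp.asboolP[w <-] maxw.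
apply/eqP; rewrite eqn_leq component_number_upper //=.
have [w' [F' [F'f]]] := component_number_lower c.
move=> F'w; apply: leq_trans (leq_trans F'w (maxw _ _)); first by rewrite leq_add2r minF.
by apply/boolp.asboolP; exists w'.
Qed.
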